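(* Let $1\le S<\infty$ and let $X(t)$ be a homogeneous birth-death process with finite state space $\{0,1,\dots,S\}$, with birth intensities $\lambda_k$ (from $k$ to $k+1$, $0\le k\le S-1$) and death intensities $\mu_k$ (from $k$ to $k-1$, $1\le k\le S$), all of which are positive. Then there exists a set $\{d_i,\ 1\le i\le S\}$ of positive numbers such that $\alpha=\alpha^*=\beta$, where $\alpha^*$ is the decay parameter of $X(t)$, and $\alpha=\min_{1\le i\le S}\alpha_i$, $\beta=\max_{1\le i\le S}\alpha_i$ are respectively the minimum and the maximum of the quantities $\alpha_i=-\sum_{j=1}^S b^{**}_{ji}$, $1\le i\le S$, formed from the entries of the matrix $B^{**}=(b^{**}_{ij})_{i,j=1}^S=DB^*D^{-1}$ with $D=\mathrm{diag}(d_1,\dots,d_S)$.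
   Context: The matrix $B^*$ is the $S\times S$ tridiagonal matrix (rows and columns indexed $1,\dots,S$) with entries $b^*_{k,k}=-(\lambda_{k-1}+\mu_k)$ for $1\le k\le S$, $b^*_{k,k+1}=\mu_k$ and $b^*_{k+1,k}=\lambda_k$ for $1\le k\le S-1$, and all other entries zero. (It is obtained from the forward Kolmogorov system of $X(t)$ by eliminating $p_0(t)=1-\sum_{i\ge1}p_i(t)$, which gives a reduced $S\times S$ matrix $B$ with entries $q_{ji}-q_{0i}$, where $q_{ji}$ ($j\ne i$) is the transition intensity from $j$ to $i$ and $q_{ii}=-\sum_{k\ne i}q_{ik}$, and then setting $B^*=TBT^{-1}$, where $T$ is the $S\times S$ upper triangular matrix with all entries on and above the diagonal equal to $1$.) Let $p_{ij}(t)=P\{X(t)=j\mid X(0)=i\}$ be the transition probabilities and $\{\pi_j\}$ the stationary probabilities of $X(t)$. The decay parameter $\alpha^*$ is the exponential rate of convergence to stationarity: the supremum of all $a>0$ such that $p_{ij}(t)-\pi_j=O(e^{-at})$ as $t\to\infty$ for all states $i,j$. *)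

(* Defs.v *)
From HB Require Import structures.
From mathcomp Require Import all_boot all_order all_algebra.
From mathcomp Require Import all_classical all_reals all_analysis.

Set Implicit Arguments.
Unset Strict Implicit.
Unset Printing Implicit Defensive.

Import Order.TTheory GRing.Theory Num.Theory.
Import numFieldNormedType.Exports.

Local Open Scope classical_set_scope.
Local Open Scope ring_scope.

(* The rates are given by [lam mu : nat -> R]; on the states 0, ..., S only
   lam 0, ..., lam (S-1) and mu 1, ..., mu S are ever used. *)
Definition jump_rate (R : realType) (S : nat) (lam mu : nat -> R)
    (i j : 'I_S.+1) : R :=
  if j == i.+1 :> nat then lam i
  else if i == j.+1 :> nat then mu i
  else 0.

Definition intensity (R : realType) (S : nat) (lam mu : nat -> R)
    (i j : 'I_S.+1) : R :=
  if i == j then - \sum_(k | k != i) jump_rate lam mu i k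
  else jump_rate lam mu i j.

(* [P i] is the law of the process started at [i]; the transition probability
   P{X(t) = j | X(0) = i} is thus the probability of [X t = j] under [P i]. *)
Definition trans_prob (R : realType) (S : nat) (disp : measure_display)
    (T : measurableType disp) (P : 'I_S.+1 -> probability T R)
    (X : R -> T -> 'I_S.+1) (i j : 'I_S.+1) (t : R) : R :=
  fine (P i [set w | X t w = j]).

(* [X t] is meaningful for [0 <= t] only. The Markov property is written in
   product form, so that conditioning events of probability 0 need no special
   treatment; [h] lists finitely many past observations (time, state). *)
Record birth_death_process (R : realType) (S : nat) (lam mu : nat -> R)
    (disp : measure_display) (T : measurableType disp)
    (P : 'I_S.+1 -> probability T R) (X : R -> T -> 'I_S.+1) : Prop := {
  bdp_measurable : forall (t : R) (j : 'I_S.+1), 0 <= t ->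
    measurable [set w | X t w = j];
  bdp_start : forall i : 'I_S.+1, P i [set w | X 0 w = i] = 1%E;
  bdp_markov : forall (i k j : 'I_S.+1) (s t : R) (h : seq (R * 'I_S.+1)),
    0 <= s -> 0 <= t -> (forall x, x \in h -> 0 <= x.1 <= s) ->
    let past := [set w | forall x, x \in h -> X x.1 w = x.2] in
    (P i (past `&` [set w | X s w = k] `&` [set w | X (s + t)%R w = j]) =
     P i (past `&` [set w | X s w = k]) * P k [set w | X t w = j])%E;
  bdp_intensity : forall i j : 'I_S.+1,
    (trans_prob P X i j h - (i == j)%:R) / h @[h --> 0^'+]
      --> intensity lam mu i j
}.

Definition stationary (R : realType) (S : nat) (disp : measure_display)
    (T : measurableType disp) (P : 'I_S.+1 -> probability T R)
    (X : R -> T -> 'I_S.+1) (p : 'I_S.+1 -> R) : Prop :=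
  [/\ forall i, 0 <= p i,
      \sum_i p i = 1 &
      forall (t : R) (j : 'I_S.+1), 0 <= t ->
        \sum_i p i * trans_prob P X i j t = p j].

(* The notation [=O_] requires its filter to be packaged as a [filter_on]. *)
Canonical pinfty_filter_on (R : realType) : filter_on R :=
  FilterType (pinfty_nbhs R) _.

(* The supremum is taken in [\bar R]: no default value is involved. *)
Definition decay_parameter (R : realType) (S : nat) (disp : measure_display)
    (T : measurableType disp) (P : 'I_S.+1 -> probability T R)
    (X : R -> T -> 'I_S.+1) (p : 'I_S.+1 -> R) : \bar R :=
  ereal_sup [set a%:E | a in [set a : R | 0 < a /\
    forall i j : 'I_S.+1,
      (fun t : R => trans_prob P X i j t - p j : R^o)
        =O_ (pinfty_nbhs R) (fun t : R => expR (- (a * t)) : R^o)]].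

(* Rows and columns 1, ..., S are represented by 'I_S: the index [i : 'I_S]
   stands for i + 1. *)
Definition Bstar (R : realType) (S : nat) (lam mu : nat -> R) : 'M[R]_S :=
  \matrix_(i, j)
    if i == j then - (lam i + mu i.+1)
    else if j == i.+1 :> nat then mu i.+1
    else if i == j.+1 :> nat then lam j.+1
    else 0.

Definition Bstarstar (R : realType) (S : nat) (lam mu : nat -> R)
    (d : 'rV[R]_S) : 'M[R]_S :=
  diag_mx d *m Bstar S lam mu *m invmx (diag_mx d).

Definition alpha (R : realType) (S : nat) (lam mu : nat -> R)
    (d : 'rV[R]_S) (i : 'I_S) : R :=
  - \sum_(j < S) Bstarstar lam mu d j i.

(* Main.v *)
Require Import Defs.
From HB Require Import structures.
From mathcomp Require Import all_boot all_order all_algebra.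
From mathcomp Require Import all_classical all_reals all_analysis.
From mathcomp Require Import ring lra.

Set Implicit Arguments.
Unset Strict Implicit.
Unset Printing Implicit Defensive.

Import Order.TTheory GRing.Theory Num.Theory.
Import numFieldNormedType.Exports.

Local Open Scope classical_set_scope.
Local Open Scope ring_scope.

(** Write [b] for the common value in the conclusion. The matrix [B^*] has
    nonnegative entries off the diagonal and is irreducible, so it has a
    positive left eigenvector [d], with an eigenvalue [- b < 0]. For this choice
    of weights each column sum of [D B^* D^-1] is [- b], hence every [alpha_i]
    is [b] ([eigenvector_exists], [alphaE]). What remains is to see that [b] is
    the decay parameter.

    The rows of [B^*] describe how the generator [Q] acts on the increments
    [g (k+1) - g k] of a function [g] on the states. Thus a function [f] with
    increments [d] satisfies [Q f = - b f] once its additive constant is chosen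
    properly, and [f] is strictly increasing.

    - No rate above [b] is possible: [P(t) f = e^(-bt) f]
      ([act_eigenfunction]), so the rows of [P(t)] at the two extreme states
      differ by exactly [e^(-bt) (f n - f 0)] when integrated against [f]
      ([decay_rate_le]).
    - Every rate [a < b] is reached: measure distances between states by [f],
      that is, let the step from [k] to [k+1] have length [d k]. For small [h]
      the Euler step [I + hQ] multiplies Lipschitz constants by at most
      [1 - bh], because its action on increments has nonnegative coefficients
      and maps [d] to [(1 - bh) d]. Hence [P(h)], which is [I + hQ + o(h)],
      multiplies them by at most [1 - ah <= e^(-ah)], and by the semigroup
      property [P(t)] multiplies them by at most [e^(-at)]
      ([lipschitz_contraction]). Applied to indicators of states this bounds
      the differences between the rows of [P(t)], and averaging over the
      stationary law gives the rate ([trans_prob_decay]).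

    Both parts cut [0, t] into many short steps and use the definition of the
    intensities on one step only, so that no differential equation has to be
    solved. In all the lemmas the boundary is encoded by vanishing rates,
    [lam n = 0] and [mu 0 = 0], which makes the formulas uniform in the state;
    the given rates are first truncated to this form. *)

(** * A positive left eigenvector of the tridiagonal matrix *)

(** [d] is a left eigenvector of [B^*] with eigenvalue [- b]; at the ends of
    the range the terms outside of it disappear with [lam n] and [mu 0]. *)
Definition eigenweights (R : realType) (n : nat) (lam mu d : nat -> R)
    (b : R) : Prop :=
  forall k, (k < n)%N ->
    lam k.+1 * d k.+1 - (lam k + mu k.+1) * d k + mu k * d k.-1 = - b * d k.

(** The second component at [k] is the determinant of [- B^* - b] restricted to
    its first [k] rows and columns, with the factors placed by a three-term
    recurrence; the first component is the preceding determinant. The pair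
    makes the recursion structural. *)
Fixpoint minor_pair (R : realType) (lam mu : nat -> R) (b : R) (k : nat) :
    R * R :=
  if k is k'.+1 then
    let xy := minor_pair lam mu b k' in
    (xy.2, (lam k' + mu k'.+1 - b) * xy.2 - lam k' * mu k' * xy.1)
  else (0, 1).

Definition minor (R : realType) (lam mu : nat -> R) (b : R) (k : nat) : R :=
  (minor_pair lam mu b k).2.

Lemma minor0 (R : realType) (lam mu : nat -> R) b : minor lam mu b 0 = 1.
Proof. by []. Qed.

Lemma minor1 (R : realType) (lam mu : nat -> R) b :
  minor lam mu b 1 = lam 0%N + mu 1%N - b.
Proof. by rewrite /minor /= mulr1 mulr0 subr0. Qed.

Lemma minorSS (R : realType) (lam mu : nat -> R) b k :
  minor lam mu b k.+2 = (lam k.+1 + mu k.+2 - b) * minor lam mu b k.+1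
    - lam k.+1 * mu k.+1 * minor lam mu b k.
Proof. by []. Qed.

Lemma continuous_minor (R : realType) (lam mu : nat -> R) k :
  continuous (fun b => minor lam mu b k).
Proof.
suff H : continuous (fun b => (minor_pair lam mu b k).1) /\
         continuous (fun b => (minor_pair lam mu b k).2) by case: H.
elim: k => [|k [c1 c2]]; first by split => b; exact: cvg_cst.
split=> //= b; apply: cvgB; apply: cvgM; [|exact: c2|exact: cvg_cst|exact: c1].
by apply: cvgB; [exact: cvg_cst|exact: cvg_id].
Qed.

(** At [b = 0] the recurrence telescopes: [minor k.+1 - mu k.+1 * minor k] is
    multiplied by a birth rate when [k] increases, hence stays positive. *)
Lemma minor_at0_gt0 (R : realType) (lam mu : nat -> R) (n : nat) :
    (forall k, (k < n)%N -> 0 < lam k) ->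
    (forall k, (0 < k <= n)%N -> 0 < mu k) ->
  forall k, (k <= n)%N -> 0 < minor lam mu 0 k.
Proof.
move=> lam_gt0 mu_gt0 k kn.
suff H : forall j, (j < n)%N ->
    0 < minor lam mu 0 j /\
    0 < minor lam mu 0 j.+1 - mu j.+1 * minor lam mu 0 j.
  case: k kn => [|k] kn; first by rewrite minor0.
  have [mk] := H k kn; rewrite subr_gt0 => /(lt_trans _); apply.
  by rewrite mulr_gt0 // mu_gt0.
elim=> [|j IHj] jn.
  rewrite minor0 minor1; split; first exact: ltr01.
  by have := lam_gt0 0%N jn; lra.
have [mj dj] := IHj (ltnW jn).
have mSj : 0 < minor lam mu 0 j.+1.
  move: dj; rewrite subr_gt0 => /(lt_trans _); apply.
  by rewrite mulr_gt0 //; apply: mu_gt0; exact: (ltnW jn).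
split=> //; rewrite minorSS.
have -> : (lam j.+1 + mu j.+2 - 0) * minor lam mu 0 j.+1
      - lam j.+1 * mu j.+1 * minor lam mu 0 j - mu j.+2 * minor lam mu 0 j.+1
    = lam j.+1 * (minor lam mu 0 j.+1 - mu j.+1 * minor lam mu 0 j) by ring.
by rewrite mulr_gt0 // lam_gt0.
Qed.

(** A Sturm type argument. Let [b0] be the supremum of the [b >= 0] at which all
    minors are positive. By continuity some minor vanishes at [b0]; if the
    first one to vanish were not the last, the recurrence would make the next
    one negative, whereas all minors are nonnegative at [b0]. *)
Lemma minor_first_root (R : realType) (lam mu : nat -> R) (n : nat) :
    (0 < n)%N ->
    (forall k, (k < n)%N -> 0 < lam k) ->
    (forall k, (0 < k <= n)%N -> 0 < mu k) ->
  exists b : R, [/\ 0 < b, minor lam mu b n = 0 &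
    forall k, (k < n)%N -> 0 < minor lam mu b k].
Proof.
move=> n_gt0 lam_gt0 mu_gt0.
pose E := [set b : R | 0 <= b /\ forall k, (k <= n)%N -> 0 < minor lam mu b k].
have E0 : E 0 by split => //; exact: minor_at0_gt0.
have ubE : ubound E (lam 0%N + mu 1%N).
  by move=> b [_ /(_ 1%N n_gt0)]; rewrite minor1; lra.
have hsE : has_sup E by split; [exists 0|exists (lam 0%N + mu 1%N)].
pose b0 := sup E.
have b0_ge0 : 0 <= b0 by apply: ub_le_sup => //; case: hsE.
have m_ge0 k : (k <= n)%N -> 0 <= minor lam mu b0 k.
  move=> kn; rewrite leNgt; apply/negP => mk_lt0.
  have : nbhs b0 [set b | minor lam mu b k < 0].
    exact: cvgr_lt (@continuous_minor R lam mu k b0) _ mk_lt0.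
  move=> /nbhs_ballP[e /= e_gt0 be].
  have [b [b_ge0 Eb] blt] := sup_adherent e_gt0 hsE.
  have b_le : b <= b0 by apply: ub_le_sup; [case: hsE|split].
  have : minor lam mu b k < 0.
    apply: be; rewrite /ball /= ger0_norm ?subr_ge0 //.
    by move: blt; rewrite -/b0; lra.
  by rewrite ltNge ltW // Eb.
have [allpos|] := pselect (forall k, (k <= n)%N -> 0 < minor lam mu b0 k).
  exfalso.
  have : nbhs b0 [set b | forall k : 'I_n.+1, 0 < minor lam mu b k].
    apply: (@filter_forall _ _
      (fun (k : 'I_n.+1) b => 0 < minor lam mu b k) (nbhs b0) _).
    move=> k; apply: (cvgr_gt _ (@continuous_minor R lam mu k b0)).
    by apply: allpos; rewrite -ltnS.
  move=> /nbhs_ballP[e /= e_gt0 be].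
  suff : b0 + e / 2 <= b0 by lra.
  apply: ub_le_sup; first by case: hsE.
  split=> [|k kn]; first by lra.
  rewrite -ltnS in kn; apply: (be _ _ (Ordinal kn)).
  by rewrite /ball /= opprD addNKr normrN ger0_norm; lra.
move=> /existsNP[k0 /not_implyP[k0n /negP]]; rewrite -leNgt => mk0.
have ex0 : exists k, (k <= n)%N && (minor lam mu b0 k == 0).
  by exists k0; rewrite k0n eq_le mk0 m_ge0.
case: (ex_minnP ex0) => k /andP[kn /eqP mk] kmin.
have mlt j : (j < k)%N -> 0 < minor lam mu b0 j.
  move=> jk; have jn := ltnW (leq_trans jk kn).
  rewrite lt_neqAle m_ge0 // andbT eq_sym; apply/negP => mj0.
  by move: jk; rewrite ltnNge kmin // jn.
have kE : k = n.
  apply/eqP; rewrite eqn_leq kn leqNgt; apply/negP => k_lt.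
  case: k mk mlt kn k_lt {kmin} => [|k] mk mlt kn k_lt.
    by move: mk; rewrite minor0 => /eqP; rewrite oner_eq0.
  have := m_ge0 _ k_lt; rewrite minorSS mk mulr0 sub0r oppr_ge0 leNgt.
  rewrite !mulr_gt0 //; [exact: lam_gt0|by apply: mu_gt0|exact: mlt].
exists b0; rewrite -{1}kE; split=> //; last by rewrite -kE.
rewrite lt_neqAle b0_ge0 andbT; apply/negP => /eqP b0E.
have := minor_at0_gt0 lam_gt0 mu_gt0 kn.
by rewrite {2}b0E mk ltxx.
Qed.

(** Dividing the minors by the products of the [lam i] turns their recurrence
    into the eigenvector equation; its last instance is the vanishing of the
    full determinant. *)
Lemma eigenvector_exists (R : realType) (n : nat) (lam mu : nat -> R) :
    (0 < n)%N ->
    (forall k, (k < n)%N -> 0 < lam k) ->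
    (forall k, (0 < k <= n)%N -> 0 < mu k) ->
    lam n = 0 -> mu 0%N = 0 ->
  exists (b : R) (d : nat -> R), [/\ 0 < b,
    forall k, (k < n)%N -> 0 < d k & eigenweights n lam mu d b].
Proof.
move=> n_gt0 lam_gt0 mu_gt0 lamn mu0.
have [b [b_gt0 mn m_gt0]] := minor_first_root n_gt0 lam_gt0 mu_gt0.
pose w k := \prod_(i < k) lam i.+1.
have w_gt0 k : (k < n)%N -> 0 < w k.
  move=> kn; apply: prodr_gt0 => i _; apply: lam_gt0.
  exact: leq_ltn_trans (ltn_ord i) kn.
exists b, (fun k => minor lam mu b k / w k); split=> // k kn.
  by rewrite divr_gt0 ?m_gt0 ?w_gt0.
have up : lam k.+1 * (minor lam mu b k.+1 / w k.+1) = minor lam mu b k.+1 / w k.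
  move: (kn); rewrite leq_eqVlt => /orP[/eqP ->|k1n].
    by rewrite lamn mn !mul0r.
  have := lt0r_neq0 (w_gt0 _ kn); have := lt0r_neq0 (lam_gt0 _ k1n).
  rewrite /w big_ord_recr /= -/(w k) => l0 w0.
  by field; rewrite l0 w0.
rewrite up; case: k kn {up} => [|k] kn.
  rewrite mu0 mul0r addr0 minor1 minor0 /w big_ord0 !divr1.
  by ring.
have := lt0r_neq0 (w_gt0 _ kn); have := lt0r_neq0 (w_gt0 _ (ltnW kn)).
have := lt0r_neq0 (lam_gt0 _ kn).
rewrite minorSS /= /w big_ord_recr /= -/(w k) => l0 w0 w1.
by field; rewrite l0 w0.
Qed.

(** * Generator, matrix action and increments *)

(** Functions on the states are written as functions on [nat], so that
    increments [g k.+1 - g k] need no casts; values beyond [n] are ignored. *)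
Definition act (R : realType) (n : nat) (M : 'M[R]_n.+1) (g : nat -> R)
    (k : nat) : R :=
  \sum_(j < n.+1) M (inord k) j * g j.

Lemma act_mulmx (R : realType) n (M N : 'M[R]_n.+1) g k :
  act (M *m N) g k = act M (act N g) k.
Proof.
rewrite /act; under eq_bigr do rewrite mxE mulr_suml.
rewrite exchange_big /=; apply: eq_bigr => l _.
by rewrite inord_val mulr_sumr; apply: eq_bigr => j _; rewrite mulrA.
Qed.

Lemma act_lin (R : realType) n (M : 'M[R]_n.+1) g g' c k :
  act M (fun j => g j - c * g' j) k = act M g k - c * act M g' k.
Proof.
rewrite /act mulr_sumr -sumrB; apply: eq_bigr => j _.
by rewrite mulrBr mulrCA.
Qed.

Lemma act_cst (R : realType) n (M : 'M[R]_n.+1) c k :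
  (forall i, \sum_j M i j = 1) -> act M (fun=> c) k = c.
Proof. by move=> M1; rewrite /act -mulr_suml M1 mul1r. Qed.

Lemma act_le (R : realType) n (M : 'M[R]_n.+1) g C k :
    (forall i j, 0 <= M i j) -> (forall i, \sum_j M i j = 1) ->
    (forall j, (j <= n)%N -> `|g j| <= C) ->
  `|act M g k| <= C.
Proof.
move=> M0 M1 gC; apply: (le_trans (ler_norm_sum _ _ _)).
rewrite -[leRHS]mul1r -(M1 (inord k)) mulr_suml; apply: ler_sum => j _.
by rewrite normrM ger0_norm // ler_wpM2l // gC // -ltnS.
Qed.

Lemma act_expansion (R : realType) n (M Q : 'M[R]_n.+1) h e g C k :
    (forall i j, `|M i j - (i == j)%:R - h * Q i j| <= e) ->
    (forall j, (j <= n)%N -> `|g j| <= C) -> (k <= n)%N ->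
  `|act M g k - g k - h * act Q g k| <= n.+1%:R * (e * C).
Proof.
move=> Me gC kn.
have -> : act M g k - g k - h * act Q g k = \sum_(j < n.+1)
    (M (inord k) j - (inord k == j)%:R - h * Q (inord k) j) * g j.
  have -> : g k = \sum_(j < n.+1) (inord k == j)%:R * g j.
    rewrite (bigD1 (inord k)) //= eqxx mul1r inordK // big1 ?addr0 // => j.
    by rewrite eq_sym => /negPf ->; rewrite mul0r.
  rewrite /act mulr_sumr -!sumrB; apply: eq_bigr => j _.
  by rewrite !mulrBl mulrA.
apply: (le_trans (ler_norm_sum _ _ _)).
have <- : \sum_(j < n.+1) e * C = n.+1%:R * (e * C).
  by rewrite sumr_const card_ord mulr_natl.
apply: ler_sum => j _.
by rewrite normrM ler_pM // gC // -ltnS.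
Qed.

(** For [k = 0] the death term vanishes, since [0.-1 = 0]; for the last state
    the birth term vanishes with the rate. *)
Definition generator (R : realType) (lam mu g : nat -> R) (k : nat) : R :=
  lam k * (g k.+1 - g k) + mu k * (g k.-1 - g k).

Lemma act_intensity (R : realType) n (lam mu g : nat -> R) k :
    lam n = 0 -> mu 0%N = 0 -> (k <= n)%N ->
  act (\matrix_(i, j < n.+1) intensity lam mu i j) g k = generator lam mu g k.
Proof.
move=> lamn mu0 kn; rewrite /act; set i : 'I_n.+1 := inord k.
have ik : i = k :> nat by rewrite inordK.
under eq_bigr do rewrite mxE.
have -> : \sum_(j < n.+1) intensity lam mu i j * g j =
    \sum_(j < n.+1) jump_rate lam mu i j * (g j - g k).
  rewrite (bigD1 i) //= [RHS](bigD1 i) //= ik subrr mulr0 add0r.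
  rewrite {1}/intensity eqxx mulNr addrC mulr_suml -sumrB.
  by apply: eq_bigr => j ji; rewrite /intensity eq_sym (negPf ji) mulrBr.
have -> : \sum_(j < n.+1) jump_rate lam mu i j * (g j - g k) =
    \sum_(j < n.+1 | j == k.+1 :> nat) lam k * (g j - g k) +
    \sum_(j < n.+1 | j == k.-1 :> nat) mu k * (g j - g k).
  rewrite [X in _ = X + _]big_mkcond [X in _ = _ + X]big_mkcond -big_split /=.
  apply: eq_bigr => j _; rewrite /jump_rate ik.
  case: (k) => [|k'].
    case: ifPn => [/eqP -> /=|_]; first by rewrite addr0.
    by rewrite mu0 !mul0r if_same addr0.
  rewrite eqSS /= [k' == j]eq_sym; case: eqP => [->|_].
    by rewrite gtn_eqF ?leqnSn // addr0.
  by rewrite add0r; case: ifP => // _; rewrite mul0r.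
rewrite (big_ord1_eq _ (fun j => lam k * (g j - g k))).
rewrite (big_ord1_eq _ (fun j => mu k * (g j - g k))).
rewrite /generator ltnS (leq_ltn_trans (leq_pred k)) //.
case: ltnP => // nk; have -> : k = n by apply/eqP; rewrite eqn_leq kn.
by rewrite lamn !mul0r.
Qed.

Lemma Bstar_colsum (R : realType) n (lam mu d : nat -> R) (i : 'I_n) :
    lam n = 0 -> mu 0%N = 0 ->
  \sum_(j < n) d j * Bstar n lam mu j i =
    lam i.+1 * d i.+1 - (lam i + mu i.+1) * d i + mu i * d i.-1.
Proof.
move=> lamn mu0.
have -> : \sum_(j < n) d j * Bstar n lam mu j i =
    \sum_(j < n | j == i.+1 :> nat) lam i.+1 * d j
    - \sum_(j < n | j == i :> nat) (lam i + mu i.+1) * d j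
    + \sum_(j < n | j == i.-1 :> nat) mu i * d j.
  rewrite [X in _ = X - _ + _]big_mkcond [X in _ = _ - X + _]big_mkcond.
  rewrite [X in _ = _ + X]big_mkcond.
  rewrite -sumrB -big_split /=; apply: eq_bigr => j _; rewrite mxE -val_eqE /=.
  move: (val i) (val j) => {}i {}j.
  have [->|ji] := eqVneq j i.
    rewrite ltn_eqF // sub0r; case: i => [|i].
      by rewrite mu0 eqxx mul0r addr0; ring.
    by rewrite gtn_eqF // addr0; ring.
  have [->|ij] := eqVneq i j.+1.
    by rewrite eqxx ltn_eqF ?leqnSn //; ring.
  have [->|ij2] := eqVneq j i.+1.
    by rewrite ?eqxx gtn_eqF ?ltnS ?leq_pred //; ring.
  have [ji1|_] := eqVneq j i.-1; last by ring.
  case: i ij ji {ij2} ji1 => [|i] /= ij ji ji1; first by rewrite ji1 eqxx in ji.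
  by rewrite ji1 eqxx in ij.
rewrite (big_ord1_eq _ (fun j => lam i.+1 * d j)).
rewrite (big_ord1_eq _ (fun j => (lam i + mu i.+1) * d j)).
rewrite (big_ord1_eq _ (fun j => mu i * d j)) ltn_ord.
rewrite (leq_ltn_trans (leq_pred i)) //.
case: ltnP => // ni; have -> : i.+1 = n.
  by apply/eqP; rewrite eqn_leq ni ltn_ord.
by rewrite lamn mul0r.
Qed.

(** * Semigroups of transition matrices *)

(** All that the proof needs from the process. The last field says that
    [P h] is [I + hQ + o(h)], in the form in which it is used. *)
Record transition_semigroup (R : realType) (n : nat) (lam mu : nat -> R)
    (P : R -> 'M[R]_n.+1) : Prop := {
  tsg_ge0 : forall t i j, 0 <= t -> 0 <= P t i j;
  tsg_sum1 : forall t i, 0 <= t -> \sum_j P t i j = 1;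
  tsg_comp : forall s t, 0 <= s -> 0 <= t -> P (s + t) = P s *m P t;
  tsg_rate : forall e : R, 0 < e -> exists2 h0 : R, 0 < h0 & forall (h : R) i j,
    0 < h < h0 -> `|P h i j - (i == j)%:R - h * intensity lam mu i j| <= h * e
}.

Lemma subdivide (R : realType) (t h0 : R) : 0 < t -> 0 < h0 ->
  exists (m : nat) (h : R), t = m.+1%:R * h /\ 0 < h < h0.
Proof.
move=> t_gt0 h0_gt0; set m := Num.bound (t / h0).
exists m, (t / m.+1%:R).
split; first by rewrite mulrC divfK ?pnatr_eq0.
rewrite divr_gt0 //= ltr_pdivrMr ?ltr0n // mulrC -ltr_pdivrMr //.
apply: lt_le_trans (archi_boundP (ltW (divr_gt0 t_gt0 h0_gt0))) _.
by rewrite ler_nat.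
Qed.

Lemma semigroup_mulS (R : realType) n lam mu (P : R -> 'M[R]_n.+1) h m :
    transition_semigroup lam mu P -> 0 < h ->
  P (m.+2%:R * h) = P h *m P (m.+1%:R * h).
Proof.
move=> hP h_gt0; rewrite -(tsg_comp hP) ?ltW //; last by rewrite mulr_gt0.
by rewrite [m.+2%:R]mulrS mulrDl mul1r.
Qed.

Lemma expRN_expansion (R : realType) (x : R) :
  0 <= x -> `|1 - x - expR (- x)| <= x ^+ 2.
Proof.
move=> x_ge0; have := expR_ge1Dx (- x); have := expR_ge1Dx x.
have := expR_gt0 (- x); have := expRxMexpNx_1 x.
move: (expR x) (expR (- x)) => u v uv v_gt0 u_ge v_ge.
rewrite ler0_norm; last lra.
have le1 : (1 + x) * v <= 1 by rewrite -[leRHS]uv ler_wpM2r // ltW.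
have : 0 <= x * (v - (1 - x)) by rewrite mulr_ge0 // subr_ge0.
nra.
Qed.

Lemma bounded_on_states (R : realType) (n : nat) (f : nat -> R) :
  exists2 C : R, 0 < C & forall j, (j <= n)%N -> `|f j| <= C.
Proof.
exists (1 + \sum_(j < n.+1) `|f j|) => [|j jn].
  by apply: ltr_wpDr; rewrite ?sumr_ge0.
rewrite -ltnS in jn; rewrite (bigD1 (Ordinal jn)) //= addrCA lerDl.
by rewrite addr_ge0 // sumr_ge0.
Qed.

(** On one step of length [h], [P h f] and [e^(-bh) f] differ by [o(h)]. As
    neither [P h] nor multiplication by [e^(-bh)] increases the sup norm, the
    errors of the [t / h] steps just add up, to [o(1)]. *)
Lemma act_eigenfunction (R : realType) n (lam mu : nat -> R)
    (P : R -> 'M[R]_n.+1) (b t : R) (f : nat -> R) k :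
    transition_semigroup lam mu P -> lam n = 0 -> mu 0%N = 0 ->
    (forall k, (k <= n)%N -> generator lam mu f k = - b * f k) ->
    0 <= b -> 0 < t -> (k <= n)%N ->
  act (P t) f k = expR (- (b * t)) * f k.
Proof.
move=> hP lamn mu0 fE b_ge0 t_gt0 kn.
have [C C_gt0 fC] := bounded_on_states n f.
apply/eqP; rewrite -subr_eq0 -normr_le0; apply/ler_addgt0Pr => e e_gt0.
rewrite add0r.
(* [e1] and [h1] make each of the two sources of error, [P h] against [I + hQ]
   and [1 - bh] against [e^(-bh)], at most half of [h * (e / t)] per step. *)
pose e1 := e / (2 * n.+1%:R * C * t).
have [|h0 h0_gt0 Ph] := tsg_rate hP (e := e1).
  by rewrite divr_gt0 // !mulr_gt0.
pose h1 := e / (2 * (1 + b ^+ 2) * C * t).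
have b2_gt0 : 0 < 1 + b ^+ 2 by rewrite ltr_pwDl // sqr_ge0.
have h1_gt0 : 0 < h1 by rewrite divr_gt0 // !mulr_gt0.
have h01_gt0 : 0 < Num.min h0 h1 by rewrite lt_min h0_gt0.
have [m [h [tE /andP[h_gt0]]]] := subdivide t_gt0 h01_gt0.
rewrite lt_min => /andP[hh0 hh1].
pose Q := \matrix_(i, j < n.+1) intensity lam mu i j.
have PQ i j : `|P h i j - (i == j)%:R - h * Q i j| <= h * e1.
  by rewrite mxE; apply: Ph; rewrite h_gt0.
have step j : (j <= n)%N ->
    `|act (P h) f j - expR (- (b * h)) * f j| <= h * (e / t).
  move=> jn.
  have -> : act (P h) f j - expR (- (b * h)) * f j =
      (act (P h) f j - f j - h * act Q f j)
      + (1 - b * h - expR (- (b * h))) * f j.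
    by rewrite act_intensity // fE //; ring.
  apply: (le_trans (ler_normD _ _)).
  have -> : h * (e / t) = h * (e / t) / 2 + h * (e / t) / 2 by field; lra.
  apply: lerD.
    apply: (le_trans (act_expansion PQ fC jn)).
    rewrite le_eqVlt; apply/orP; left; apply/eqP.
    by rewrite /e1; field; rewrite !lt0r_neq0 // ltr0n.
  rewrite normrM.
  apply: (le_trans (ler_pM _ _ (expRN_expansion _) (fC _ jn))) => //.
    by rewrite mulr_ge0 // ltW.
  have -> : (b * h) ^+ 2 * C = h * (h * b ^+ 2 * C) by ring.
  rewrite -[leRHS]mulrA ler_pM2l //.
  have : h * (2 * (1 + b ^+ 2) * C * t) <= e.
    by rewrite -ler_pdivlMr ?ltW // !mulr_gt0.
  rewrite ler_pdivlMr // => he; rewrite ler_pdivlMr //.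
  apply: le_trans he.
  have : 0 <= h * C * t by rewrite !mulr_ge0 // ltW.
  move: (sqr_ge0 b) => b2 hCt.
  have -> : h * b ^+ 2 * C * 2 * t = 2 * b ^+ 2 * (h * C * t) by ring.
  have -> : h * (2 * (1 + b ^+ 2) * C * t) = 2 * (1 + b ^+ 2) * (h * C * t).
    by ring.
  by apply: ler_wpM2r => //; lra.
have iter j m' : (j <= n)%N ->
    `|act (P (m'.+1%:R * h)) f j - expR (- (b * (m'.+1%:R * h))) * f j|
      <= m'.+1%:R * h * (e / t).
  elim: m' j => [|m' IH] j jn; first by rewrite !mul1r; exact: step.
  set E := expR (- (b * (m'.+1%:R * h))).
  have E01 : 0 <= E <= 1.
    by rewrite ltW ?expR_gt0 //= -expR0 ler_expR oppr_le0 !mulr_ge0 // ltW.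
  have EE : expR (- (b * (m'.+2%:R * h))) = E * expR (- (b * h)).
    by rewrite /E -expRD; congr expR; rewrite [m'.+2%:R]mulrS; ring.
  rewrite (semigroup_mulS _ hP) // act_mulmx EE.
  set g := act (P (m'.+1%:R * h)) f.
  have -> : act (P h) g j - E * expR (- (b * h)) * f j =
     act (P h) (fun i => g i - E * f i) j
     + E * (act (P h) f j - expR (- (b * h)) * f j).
    by rewrite act_lin; ring.
  apply: (le_trans (ler_normD _ _)).
  have -> : m'.+2%:R * h * (e / t) = m'.+1%:R * h * (e / t) + h * (e / t).
    by rewrite [m'.+2%:R]mulrS; ring.
  apply: lerD.
    apply: act_le; [by move=> *; apply: (tsg_ge0 hP); exact: ltW
      |by move=> *; apply: (tsg_sum1 hP); exact: ltW|exact: IH].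
  rewrite normrM ger0_norm; last by case/andP: E01.
  rewrite -[leRHS]mul1r; apply: ler_pM => //; [by case/andP: E01
    |by case/andP: E01|exact: step].
rewrite tE; apply: (le_trans (iter _ _ kn)).
rewrite -tE mulrC divfK //; exact: lt0r_neq0.
Qed.

(** Lipschitz functions for the distance on the states in which [k] and [k.+1]
    are at distance [d k]. *)
Definition lipschitz_wrt (R : realType) (n : nat) (d : nat -> R) (c : R)
    (g : nat -> R) : Prop :=
  forall k, (k < n)%N -> `|g k.+1 - g k| <= c * d k.

Lemma lipschitz_wrt_bound (R : realType) n (d : nat -> R) c g j :
    lipschitz_wrt n d c g -> 0 <= c -> (forall k, (k < n)%N -> 0 < d k) ->
    (j <= n)%N ->
  `|g j - g 0%N| <= c * \sum_(i < n) d i.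
Proof.
move=> gL c_ge0 d_gt0 jn.
apply: (@le_trans _ _ (c * \sum_(i < j) d i)).
  elim: j jn => [|j IH] jn; first by rewrite subrr normr0 big_ord0 mulr0.
  rewrite big_ord_recr /= mulrDr [leRHS]addrC -(subrKA (g j)).
  by rewrite (le_trans (ler_normD _ _)) // lerD // ?gL // IH // ltnW.
apply: ler_wpM2l => //; rewrite -(subnK jn) addnC big_split_ord /= lerDl.
apply: sumr_ge0 => i _; apply/ltW/d_gt0.
by rewrite -{2}(subnKC jn) ltn_add2l.
Qed.

Lemma weights_min (R : realType) n (d : nat -> R) :
  (forall k, (k < n)%N -> 0 < d k) ->
  exists2 x : R, 0 < x & forall k, (k < n)%N -> x <= d k.
Proof.
elim: n => [|n IH] d_gt0; first by exists 1.
have [|x x_gt0 xd] := IH; first by move=> k kn; apply/d_gt0/ltnW.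
exists (Num.min x (d n)); first by rewrite lt_min x_gt0 d_gt0.
move=> k; rewrite ltnS leq_eqVlt => /orP[/eqP ->|kn].
  by rewrite ge_min lexx orbT.
by rewrite ge_min xd.
Qed.

(** The coefficients on the right are the entries of [B^*], which is thus the
    generator read on increments. *)
Lemma generator_increment (R : realType) (lam mu g : nat -> R) k :
    mu 0%N = 0 ->
  generator lam mu g k.+1 - generator lam mu g k =
    lam k.+1 * (g k.+2 - g k.+1) - (lam k + mu k.+1) * (g k.+1 - g k)
    + mu k * (g k.-1.+1 - g k.-1).
Proof.
by rewrite /generator; case: k => [|k] /= mu0; rewrite ?mu0; ring.
Qed.

(** The increments of [g + h Q g] are combinations of those of [g], with
    nonnegative coefficients when [h] is small, so the worst case is the one
    where [g] has increments [c * d k]; there [d] being an eigenvector gives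
    the factor [1 - b * h]. *)
Lemma lipschitz_euler_step (R : realType) n (lam mu d g : nat -> R) b c h k :
    lam n = 0 -> mu 0%N = 0 ->
    (forall k, (k <= n)%N -> 0 <= lam k) ->
    (forall k, (k <= n)%N -> 0 <= mu k) ->
    eigenweights n lam mu d b ->
    lipschitz_wrt n d c g -> 0 <= h -> (k < n)%N ->
    h * (lam k + mu k.+1) <= 1 ->
  `|g k.+1 - g k + h * (generator lam mu g k.+1 - generator lam mu g k)|
    <= c * ((1 - b * h) * d k).
Proof.
move=> lamn mu0 lam_ge0 mu_ge0 dE gL h_ge0 kn hk.
rewrite (generator_increment _ _ _ mu0).
have -> : c * ((1 - b * h) * d k) = (1 - h * (lam k + mu k.+1)) * (c * d k)
    + h * (lam k.+1 * (c * d k.+1)) + h * (mu k * (c * d k.-1)).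
  have -> : c * ((1 - b * h) * d k) = c * d k + c * h * (- b * d k) by ring.
  by rewrite -dE //; ring.
have -> : g k.+1 - g k + h * (lam k.+1 * (g k.+2 - g k.+1)
      - (lam k + mu k.+1) * (g k.+1 - g k) + mu k * (g k.-1.+1 - g k.-1)) =
    (1 - h * (lam k + mu k.+1)) * (g k.+1 - g k)
    + h * (lam k.+1 * (g k.+2 - g k.+1)) + h * (mu k * (g k.-1.+1 - g k.-1)).
  by ring.
apply: (le_trans (ler_normD _ _)); apply: lerD; last first.
  have muk := mu_ge0 k (ltnW kn).
  rewrite normrM (ger0_norm h_ge0) normrM (ger0_norm muk).
  do 2!(apply: ler_wpM2l => //).
  by apply: gL; exact: leq_ltn_trans (leq_pred k) kn.
apply: (le_trans (ler_normD _ _)); apply: lerD.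
  rewrite normrM ger0_norm; last by lra.
  by apply: ler_wpM2l; [lra|exact: gL].
rewrite normrM (ger0_norm h_ge0) normrM (ger0_norm (lam_ge0 _ kn)).
apply: ler_wpM2l => //; move: kn; rewrite leq_eqVlt => /orP[/eqP ->|kn].
  by rewrite lamn !mul0r.
by apply: ler_wpM2l; [rewrite lam_ge0 // ltnW|exact: gL].
Qed.

(** Replacing [I + hQ] by [P h] costs [o(h)], which the gap between [a] and [b]
    absorbs. *)
Lemma lipschitz_short_time (R : realType) n (lam mu d : nat -> R) b a
    (P : R -> 'M[R]_n.+1) :
    transition_semigroup lam mu P -> lam n = 0 -> mu 0%N = 0 ->
    (forall k, (k <= n)%N -> 0 <= lam k) ->
    (forall k, (k <= n)%N -> 0 <= mu k) ->
    (forall k, (k < n)%N -> 0 < d k) ->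
    eigenweights n lam mu d b ->
    a < b ->
  exists2 h0 : R, 0 < h0 & forall (h c : R) g, 0 < h < h0 -> 0 <= c ->
    lipschitz_wrt n d c g ->
    lipschitz_wrt n d (c * expR (- (a * h))) (act (P h) g).
Proof.
move=> hP lamn mu0 lam_ge0 mu_ge0 d_gt0 dE ab.
have [x x_gt0 xd] := weights_min d_gt0.
have [L L_gt0 hL] := bounded_on_states n (fun k => lam k + mu k.+1).
pose D := 1 + \sum_(i < n) d i.
have sd_ge0 : 0 <= \sum_(i < n) d i.
  by apply: sumr_ge0 => i _; apply/ltW/d_gt0.
have D_gt0 : 0 < D by rewrite /D; lra.
(* The error bound of [act_expansion] occurs at both ends of an increment: this
   [e] makes the total at most [h * c * (b - a) * d k]. *)
pose e := (b - a) * x / (2 * n.+1%:R * D).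
have ba_gt0 : 0 < b - a by lra.
have e_gt0 : 0 < e by rewrite divr_gt0 // !mulr_gt0.
have [h0 h0_gt0 Ph] := tsg_rate hP e_gt0.
have L1_gt0 : 0 < L^-1 by rewrite invr_gt0.
exists (Num.min h0 L^-1); first by rewrite lt_min h0_gt0.
move=> h c g; rewrite lt_min => /and3P[h_gt0 hh0 hhL] c_ge0 gL k kn.
(* Normalized to vanish at 0, [g] is bounded by a multiple of [c], so that the
   error is proportional to [c]; the factor 1 is there to match [act_lin]. *)
pose G j := g j - 1 * g 0%N.
have actG j : act (P h) G j = act (P h) g j - g 0%N.
  rewrite /G (act_lin _ _ (fun=> g 0%N)) act_cst ?mul1r // => i.
  exact: (tsg_sum1 hP _ (ltW h_gt0)).
pose Q := \matrix_(i, j < n.+1) intensity lam mu i j.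
have GC j : (j <= n)%N -> `|G j| <= c * D.
  move=> jn; rewrite /G mul1r.
  apply: (le_trans (lipschitz_wrt_bound gL c_ge0 d_gt0 jn)).
  by apply: ler_wpM2l => //; rewrite /D; lra.
have err j : (j <= n)%N ->
    `|act (P h) G j - G j - h * generator lam mu G j|
      <= h * c * ((b - a) * x / 2).
  move=> jn; rewrite -(act_intensity G lamn mu0 jn) -/Q.
  have PQ i l : `|P h i l - (i == l)%:R - h * Q i l| <= h * e.
    by rewrite mxE; apply: Ph; rewrite h_gt0.
  apply: (le_trans (act_expansion PQ GC jn)).
  rewrite le_eqVlt; apply/orP; left; apply/eqP.
  by rewrite /e; field; rewrite !lt0r_neq0 // ltr0n.
have GL : lipschitz_wrt n d c G.
  by move=> j jn; rewrite /G opprB addrA subrK; exact: gL.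
have hk : h * (lam k + mu k.+1) <= 1.
  rewrite -(mulVf (lt0r_neq0 L_gt0)); apply: ler_pM.
  - exact: ltW.
  - by rewrite addr_ge0 ?lam_ge0 ?mu_ge0 // ltnW.
  - exact: ltW.
  - by apply: le_trans (hL k (ltnW kn)); exact: ler_norm.
have main :=
  lipschitz_euler_step lamn mu0 lam_ge0 mu_ge0 dE GL (ltW h_gt0) kn hk.
have -> : act (P h) g k.+1 - act (P h) g k =
  (G k.+1 - G k + h * (generator lam mu G k.+1 - generator lam mu G k))
  + ((act (P h) G k.+1 - G k.+1 - h * generator lam mu G k.+1)
    - (act (P h) G k - G k - h * generator lam mu G k)).
  by rewrite !actG; ring.
apply: (le_trans (ler_normD _ _)).
apply: (@le_trans _ _ (c * ((1 - b * h) * d k) + h * c * ((b - a) * x))).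
  apply: lerD => //; apply: (le_trans (ler_normB _ _)).
  have -> : h * c * ((b - a) * x) =
    h * c * ((b - a) * x / 2) + h * c * ((b - a) * x / 2) by field.
  by apply: lerD; apply: err => //; exact: ltnW.
apply: (@le_trans _ _ (c * ((1 - a * h) * d k))).
  have -> : c * ((1 - a * h) * d k) =
    c * ((1 - b * h) * d k) + h * c * ((b - a) * d k) by ring.
  rewrite lerD2l; apply: ler_wpM2l; first by rewrite mulr_ge0 // ltW.
  by rewrite ler_pM2l // xd.
rewrite -mulrA; apply: ler_wpM2l => //; apply: ler_wpM2r.
  by apply/ltW/d_gt0.
by have := expR_ge1Dx (- (a * h)).
Qed.

Lemma lipschitz_contraction (R : realType) n (lam mu d : nat -> R) b a
    (P : R -> 'M[R]_n.+1) t c g :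
    transition_semigroup lam mu P -> lam n = 0 -> mu 0%N = 0 ->
    (forall k, (k <= n)%N -> 0 <= lam k) ->
    (forall k, (k <= n)%N -> 0 <= mu k) ->
    (forall k, (k < n)%N -> 0 < d k) ->
    eigenweights n lam mu d b ->
    a < b -> 0 < t -> 0 <= c -> lipschitz_wrt n d c g ->
  lipschitz_wrt n d (c * expR (- (a * t))) (act (P t) g).
Proof.
move=> hP lamn mu0 lam_ge0 mu_ge0 d_gt0 dE ab t_gt0 c_ge0 gL.
have [h0 h0_gt0 short] :=
  lipschitz_short_time hP lamn mu0 lam_ge0 mu_ge0 d_gt0 dE ab.
have [m [h [-> hh]]] := subdivide t_gt0 h0_gt0.
elim: m => [|m IH] {t t_gt0}; first by rewrite mul1r; exact: short.
have h_gt0 : 0 < h by case/andP: hh.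
have -> : c * expR (- (a * (m.+2%:R * h))) =
    c * expR (- (a * (m.+1%:R * h))) * expR (- (a * h)).
  by rewrite -mulrA -expRD; congr (_ * expR _); rewrite [m.+2%:R]mulrS; ring.
move=> k kn; rewrite (semigroup_mulS _ hP) // !act_mulmx.
by apply: short => //; rewrite mulr_ge0 // expR_ge0.
Qed.

(** * The eigenfunction of the generator *)

(** The increments of [Q f + b f] vanish by the choice of [d], so it is
    constant; the additive constant in [f] is the one for which it vanishes at
    state 0. *)
Lemma eigenfunction_exists (R : realType) n (lam mu d : nat -> R) (b : R) :
    mu 0%N = 0 -> b != 0 ->
    eigenweights n lam mu d b ->
  exists f : nat -> R, (forall k, f k.+1 - f k = d k) /\
    forall k, (k <= n)%N -> generator lam mu f k = - b * f k.
Proof.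
move=> mu0 b_neq0 dE.
pose f k := \sum_(i < k) d i - lam 0%N * d 0%N / b.
have fS k : f k.+1 - f k = d k by rewrite /f big_ord_recr /=; ring.
exists f; split=> //; elim=> [_|k IH kn].
  by rewrite /generator mu0 fS mul0r addr0 /f big_ord0 sub0r; field.
have := generator_increment lam f k mu0.
rewrite !fS dE // IH ?(ltnW kn) // => /eqP; rewrite subr_eq => /eqP ->.
by rewrite -(fS k); ring.
Qed.

(** * Vanishing rates at the boundary *)

Definition birth_rates (R : realType) (n : nat) (lam : nat -> R)
    (k : nat) : R :=
  if (k < n)%N then lam k else 0.

Definition death_rates (R : realType) (n : nat) (mu : nat -> R) (k : nat) : R :=
  if (0 < k <= n)%N then mu k else 0.

Lemma jump_rate_trunc (R : realType) n (lam mu : nat -> R) (i j : 'I_n.+1) :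
  jump_rate (birth_rates n lam) (death_rates n mu) i j = jump_rate lam mu i j.
Proof.
rewrite /jump_rate /birth_rates /death_rates.
case: eqP => [ji|_]; first by rewrite -ltnS -ji ltn_ord.
by case: eqP => // ij; rewrite {1}ij /= -ltnS ltn_ord.
Qed.

Lemma intensity_trunc (R : realType) n (lam mu : nat -> R) (i j : 'I_n.+1) :
  intensity (birth_rates n lam) (death_rates n mu) i j = intensity lam mu i j.
Proof.
rewrite /intensity jump_rate_trunc; congr (if _ then - _ else _).
by apply: eq_bigr => k _; rewrite jump_rate_trunc.
Qed.

Lemma Bstar_trunc (R : realType) n (lam mu : nat -> R) :
  Bstar n (birth_rates n lam) (death_rates n mu) = Bstar n lam mu.
Proof.
apply/matrixP => i j; rewrite !mxE /birth_rates /death_rates ltn_ord /=.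
case: ifP => // _; case: ifP => // _.
by case: eqP => // <-; rewrite ltn_ord.
Qed.

(** * From the process to the semigroup *)

Definition trans_mx (R : realType) (n : nat) (disp : measure_display)
    (T : measurableType disp) (P : 'I_n.+1 -> probability T R)
    (X : R -> T -> 'I_n.+1) (t : R) : 'M[R]_n.+1 :=
  \matrix_(i, j) trans_prob P X i j t.

Lemma measure_split (R : realType) n (disp : measure_display)
    (T : measurableType disp) (Q : probability T R) (A : set T)
    (Y : T -> 'I_n.+1) :
    measurable A -> (forall j, measurable [set w | Y w = j]) ->
  Q A = (\sum_(j < n.+1) Q (A `&` [set w | Y w = j]))%E.
Proof.
move=> mA mY; rewrite -measure_bigsetU_ord.
- congr (Q _); rewrite -bigcup_mkord_ord -setI_bigcupr.
  rewrite [X in A `&` X](_ : _ = setT) ?setIT //.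
  apply/seteqP; split=> // w _; exists (Y w : nat) => //=.
  by rewrite inord_val.
- by move=> j; exact: measurableI.
- apply/trivIsetP => i j _ _ ij; rewrite setIACA -subset0.
  by move=> w [_ [/= -> /eqP]]; rewrite (negPf ij).
Qed.

(** Chapman-Kolmogorov is the Markov property with an empty past, summed over
    the state at time [s]. *)
Lemma transition_semigroup_process (R : realType) n (lam mu : nat -> R)
    (disp : measure_display) (T : measurableType disp)
    (P : 'I_n.+1 -> probability T R) (X : R -> T -> 'I_n.+1) :
    birth_death_process lam mu P X ->
  transition_semigroup lam mu (trans_mx P X).
Proof.
move=> hX.
have mX t j : 0 <= t -> measurable [set w | X t w = j].
  exact: (bdp_measurable hX).
have tE i j t : 0 <= t -> (trans_prob P X i j t)%:E = P i [set w | X t w = j].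
  by move=> t_ge0; rewrite /trans_prob fineK // fin_num_measure //; exact: mX.
split.
- by move=> t i j _; rewrite mxE fine_ge0.
- move=> t i t_ge0; apply: EFin_inj; rewrite -sumEFin.
  under eq_bigr do rewrite mxE tE //.
  rewrite -(probability_setT (P i)).
  rewrite (measure_split _ measurableT (fun j => mX t j t_ge0)).
  by apply: eq_bigr => j _; rewrite setTI.
- move=> s t s_ge0 t_ge0; apply/matrixP => i j; rewrite !mxE.
  apply: EFin_inj; rewrite tE ?addr_ge0 // -sumEFin.
  rewrite (measure_split _ (mX _ j (addr_ge0 s_ge0 t_ge0))
    (fun k => mX s k s_ge0)).
  apply: eq_bigr => k _; rewrite !mxE EFinM !tE //.
  have /= := @bdp_markov _ _ _ _ _ _ _ _ hX i k j s t [::] s_ge0 t_ge0.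
  have -> : [set w | forall x, x \in [::] -> X x.1 w = x.2] = setT :> set T.
    by apply/seteqP; split.
  by rewrite !setTI setIC => ->.
- move=> e e_gt0.
  have : \forall h \near 0^'+, forall ij : 'I_n.+1 * 'I_n.+1,
      `|intensity lam mu ij.1 ij.2
        - (trans_prob P X ij.1 ij.2 h - (ij.1 == ij.2)%:R) / h| <= e.
    apply: filter_forall => -[i j] /=.
    by have /cvgrPdist_le := @bdp_intensity _ _ _ _ _ _ _ _ hX i j; exact.
  move=> /nbhs_ballP[h0 /= h0_gt0 H].
  exists h0 => // h i j /andP[h_gt0 hh0]; rewrite mxE.
  have := H h _ h_gt0 (i, j) => /=.
  rewrite /ball /= sub0r normrN gtr0_norm // => /(_ hh0) {}H.
  have -> : trans_prob P X i j h - (i == j)%:R - h * intensity lam mu i j =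
      - (h * (intensity lam mu i j - (trans_prob P X i j h - (i == j)%:R) / h)).
    by field; exact: lt0r_neq0.
  by rewrite normrN normrM gtr0_norm // ler_pM2l.
Qed.

(** * The decay parameter *)

(** The function [k |-> P_kj(t)] is the image under [P(t)] of the indicator of
    [j], so its Lipschitz constant decays; by stationarity [p j] is an average
    of the values of this function. *)
Lemma trans_prob_decay (R : realType) n (lam mu d : nat -> R) (b a : R)
    (disp : measure_display) (T : measurableType disp)
    (P : 'I_n.+1 -> probability T R) (X : R -> T -> 'I_n.+1) p i j :
    transition_semigroup lam mu (trans_mx P X) -> lam n = 0 -> mu 0%N = 0 ->
    (forall k, (k <= n)%N -> 0 <= lam k) ->
    (forall k, (k <= n)%N -> 0 <= mu k) ->
    (forall k, (k < n)%N -> 0 < d k) ->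
    eigenweights n lam mu d b ->
    stationary P X p -> a < b ->
  exists2 K : R, 0 < K & forall t, 0 < t ->
    `|trans_prob P X i j t - p j| <= K * expR (- (a * t)).
Proof.
move=> hP lamn mu0 lam_ge0 mu_ge0 d_gt0 dE [p_ge0 p1 pP] ab.
have [x x_gt0 xd] := weights_min d_gt0.
pose g m : R := (m == j :> nat)%:R.
have gL : lipschitz_wrt n d x^-1 g.
  move=> k kn; apply: (@le_trans _ _ 1).
    by rewrite /g; case: eqP; case: eqP => _ _;
      rewrite ?subrr ?subr0 ?sub0r ?normrN ?normr0 ?normr1.
  by rewrite mulrC ler_pdivlMr // mul1r xd.
have gE t k : act (trans_mx P X t) g k = trans_prob P X (inord k) j t.
  rewrite /act (bigD1 j) //= /g eqxx mulr1 big1 ?addr0 ?mxE // => l lj.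
  by move: lj; rewrite -val_eqE /= => /negPf ->; rewrite mulr0.
pose D := \sum_(k < n) d k.
have D_ge0 : 0 <= D by apply: sumr_ge0 => k _; apply/ltW/d_gt0.
exists (1 + 2 * x^-1 * D) => [|t t_gt0].
  by rewrite ltr_pwDl // !mulr_ge0 // invr_ge0 ltW.
have xV_ge0 : 0 <= x^-1 by rewrite invr_ge0 ltW.
have GL := lipschitz_contraction hP lamn mu0 lam_ge0 mu_ge0 d_gt0 dE ab
  t_gt0 xV_ge0 gL.
have C_ge0 : 0 <= x^-1 * expR (- (a * t)) by rewrite mulr_ge0 // expR_ge0.
have G0 k : `|trans_prob P X k j t - trans_prob P X ord0 j t|
    <= x^-1 * expR (- (a * t)) * D.
  have kn : (k <= n)%N by rewrite -ltnS.
  have := lipschitz_wrt_bound GL C_ge0 d_gt0 kn.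
  rewrite !gE inord_val; congr (`|_ - trans_prob _ _ _ _ _| <= _).
  by apply/val_inj; rewrite /= inordK.
have -> : trans_prob P X i j t - p j =
    \sum_k p k * (trans_prob P X i j t - trans_prob P X k j t).
  under [RHS]eq_bigr do rewrite mulrBr.
  by rewrite sumrB -mulr_suml p1 mul1r pP // ltW.
apply: (le_trans (ler_norm_sum _ _ _)).
apply: (@le_trans _ _ (\sum_k p k * (2 * x^-1 * D * expR (- (a * t))))).
  apply: ler_sum => k _; rewrite normrM ger0_norm //; apply: ler_wpM2l => //.
  rewrite -(subrKA (trans_prob P X ord0 j t)).
  apply: (le_trans (ler_normD _ _)).
  have -> : 2 * x^-1 * D * expR (- (a * t)) =
    x^-1 * expR (- (a * t)) * D + x^-1 * expR (- (a * t)) * D by ring.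
  by apply: lerD; rewrite ?G0 // distrC G0.
rewrite -mulr_suml p1 mul1r ler_wpM2r ?expR_ge0 //; lra.
Qed.

(** The test function [f] sees the rate [b] exactly: [P_nj(t) - P_0j(t)]
    integrated against [f] is [e^(-bt) (f n - f 0)], and [f n - f 0] is
    nonzero. *)
Lemma decay_rate_le (R : realType) n (lam mu d : nat -> R) (b a : R)
    (disp : measure_display) (T : measurableType disp)
    (P : 'I_n.+1 -> probability T R) (X : R -> T -> 'I_n.+1)
    (p : 'I_n.+1 -> R) :
    transition_semigroup lam mu (trans_mx P X) -> lam n = 0 -> mu 0%N = 0 ->
    (0 < n)%N -> 0 < b ->
    (forall k, (k < n)%N -> 0 < d k) ->
    eigenweights n lam mu d b ->
    (forall i j : 'I_n.+1,
      (fun t : R => trans_prob P X i j t - p j : R^o)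
        =O_ (pinfty_nbhs R) (fun t : R => expR (- (a * t)) : R^o)) ->
  a <= b.
Proof.
move=> hP lamn mu0 n_gt0 b_gt0 d_gt0 dE hO; rewrite leNgt; apply/negP => ab.
have [f [fS fE]] := eigenfunction_exists mu0 (lt0r_neq0 b_gt0) dE.
have f_lt : f 0%N < f n.
  case: n n_gt0 d_gt0 {P X p hP lamn dE hO fE} => // n _ d_gt0.
  elim: n d_gt0 => [|n IH] d_gt0; first by rewrite -subr_gt0 fS d_gt0.
  apply: (lt_trans (IH _)); first by move=> k kn; apply/d_gt0/ltnW.
  by rewrite -subr_gt0 fS d_gt0.
have /choice[K HK] : forall ij : 'I_n.+1 * 'I_n.+1, exists k : R,
    \forall t \near +oo, `|trans_prob P X ij.1 ij.2 t - p ij.2|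
      <= k * expR (- (a * t)).
  move=> [i j]; have /eqO_exP[k _ kP] := hO i j; exists k.
  apply: filterS kP => t /=; rewrite [`|expR _|]ger0_norm ?expR_ge0 //.
pose C := \sum_(j < n.+1) (K (ord_max, j) + K (ord0, j)) * `|f j|.
have : \forall t \near +oo, forall ij : 'I_n.+1 * 'I_n.+1,
    `|trans_prob P X ij.1 ij.2 t - p ij.2| <= K ij * expR (- (a * t)).
  apply: (@filter_forall _ _ (fun (ij : 'I_n.+1 * 'I_n.+1) t =>
    `|trans_prob P X ij.1 ij.2 t - p ij.2| <= K ij * expR (- (a * t)))
    (pinfty_nbhs R) _).
  exact: HK.
move=> near1.
have near2 : \forall t \near +oo, 0 < t :> R by exact: nbhs_pinfty_gt.
have near3 : \forall t \near +oo, C / ((f n - f 0%N) * (a - b)) < t :> R.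
  by apply: nbhs_pinfty_gt; exact: num_real.
have [t [[H1 t_gt0] H3]] := filter_ex (filterI (filterI near1 near2) near3).
have ef k := act_eigenfunction hP lamn mu0 fE (ltW b_gt0) t_gt0 (k := k).
have key : expR (- (b * t)) * (f n - f 0%N) <= C * expR (- (a * t)).
  rewrite mulrBr -!ef // /act -sumrB mulr_suml.
  apply: ler_sum => j _; rewrite !mxE -mulrBl.
  apply: (le_trans (ler_norm _)); rewrite normrM mulrAC ler_wpM2r //.
  have -> : inord n = ord_max :> 'I_n.+1 by apply/val_inj; rewrite /= inordK.
  have -> : inord 0 = ord0 :> 'I_n.+1 by apply/val_inj; rewrite /= inordK.
  rewrite -[X in X - _](subrK (p j)) -addrA -[X in _ + X]opprB mulrDl.
  apply: (le_trans (ler_normB _ _)).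
  by apply: lerD; [exact: (H1 (ord_max, j))|exact: (H1 (ord0, j))].
(* A gap [a - b > 0] would make the left-hand side grow without bound in [t];
   the linear lower bound of the exponential is enough. *)
have key2 : expR ((a - b) * t) * (f n - f 0%N) <= C.
  have -> : (a - b) * t = a * t - b * t by ring.
  rewrite expRD mulrAC -mulrA mulrC -ler_pdivlMr ?expR_gt0 // -expRN.
  by rewrite mulrC.
have : C < (a - b) * t * (f n - f 0%N).
  move: H3; rewrite ltr_pdivrMr ?mulr_gt0 ?subr_gt0 //.
  have -> : t * ((f n - f 0%N) * (a - b)) = (a - b) * t * (f n - f 0%N) by ring.
  by [].
apply/negP; rewrite -leNgt; apply: le_trans key2.
apply: ler_wpM2r; first by rewrite subr_ge0 ltW.
by apply: le_trans (expR_ge1Dx _); rewrite lerDr.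
Qed.

(** * The column sums of the weighted matrix *)

Lemma alphaE (R : realType) n (lam mu d : nat -> R) (b : R) (i : 'I_n) :
    lam n = 0 -> mu 0%N = 0 ->
    (forall k, (k < n)%N -> 0 < d k) ->
    eigenweights n lam mu d b ->
  alpha lam mu (\row_k d k) i = b.
Proof.
move=> lamn mu0 d_gt0 dE; rewrite /alpha /Bstarstar.
set D := diag_mx _; set B := Bstar _ _ _.
have D_unit : D \in unitmx.
  rewrite unitmxE det_diag unitfE; apply/prodf_neq0 => k _.
  by rewrite mxE lt0r_neq0 // d_gt0.
have di_neq0 : d i != 0 by rewrite lt0r_neq0 // d_gt0.
apply: (mulIf di_neq0); rewrite mulNr mulr_suml.
have colE j : (D *m B *m invmx D) j i * d i = d j * B j i.
  have /matrixP/(_ j i) := mulmxKV D_unit (D *m B).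
  by rewrite /D mul_mx_diag mul_diag_mx !mxE.
under eq_bigr do rewrite colE.
by rewrite Bstar_colsum // dE // mulNr opprK.
Qed.

Lemma alpha_trunc (R : realType) n (lam mu : nat -> R) (d : 'rV[R]_n) i :
  alpha (birth_rates n lam) (death_rates n mu) d i = alpha lam mu d i.
Proof. by rewrite /alpha /Bstarstar Bstar_trunc. Qed.

Lemma big_mine_cst (R : realType) n (x : \bar R) : (0 < n)%N ->
  (\big[mine/+oo]_(i < n) x = x)%E.
Proof.
case: n => // n _; elim: n => [|n IH].
  by rewrite big_ord_recl big_ord0 miney.
by rewrite big_ord_recl IH minxx.
Qed.

Lemma big_maxe_cst (R : realType) n (x : \bar R) : (0 < n)%N ->
  (\big[maxe/-oo]_(i < n) x = x)%E.
Proof.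
case: n => // n _; elim: n => [|n IH].
  by rewrite big_ord_recl big_ord0 maxeNy.
by rewrite big_ord_recl IH maxxx.
Qed.

Theorem theorem3 (R : realType) (S : nat) (hS : (1 <= S)%N)
    (lam mu : nat -> R)
    (hlam : forall k : nat, (k < S)%N -> 0 < lam k)
    (hmu : forall k : nat, (1 <= k <= S)%N -> 0 < mu k)
    (disp : measure_display) (T : measurableType disp)
    (P : 'I_S.+1 -> probability T R) (X : R -> T -> 'I_S.+1)
    (hX : birth_death_process lam mu P X)
    (p : 'I_S.+1 -> R) (hp : stationary P X p) :
  exists d : 'rV[R]_S,
    [/\ forall i : 'I_S, 0 < d ord0 i,
        (\big[mine/+oo]_(i < S) (alpha lam mu d i)%:E
           = decay_parameter P X p)%E &
        (decay_parameter P X p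
           = \big[maxe/-oo]_(i < S) (alpha lam mu d i)%:E)%E].
Proof.
pose lam' := birth_rates S lam; pose mu' := death_rates S mu.
have lam'S : lam' S = 0 by rewrite /lam' /birth_rates ltnn.
have mu'0 : mu' 0%N = 0 by [].
have lam'_gt0 k : (k < S)%N -> 0 < lam' k.
  by move=> kS; rewrite /lam' /birth_rates kS hlam.
have mu'_gt0 k : (0 < k <= S)%N -> 0 < mu' k.
  by move=> kS; rewrite /mu' /death_rates kS hmu.
have lam'_ge0 k : (k <= S)%N -> 0 <= lam' k.
  move=> kS; rewrite /lam' /birth_rates.
  by case: ifP => // kS'; rewrite ltW ?hlam.
have mu'_ge0 k : (k <= S)%N -> 0 <= mu' k.
  move=> kS; rewrite /mu' /death_rates.
  by case: ifP => // kS'; rewrite ltW ?hmu.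
have [b [d [b_gt0 d_gt0 dE]]] :=
  eigenvector_exists hS lam'_gt0 mu'_gt0 lam'S mu'0.
have hP : transition_semigroup lam' mu' (trans_mx P X).
  have [P0 P1 PM PQ] := transition_semigroup_process hX.
  split=> // e /PQ[h0 h0_gt0 H]; exists h0 => // h i j hh.
  by rewrite intensity_trunc; exact: H.
have decayE : decay_parameter P X p = b%:E.
  apply/eqP; rewrite eq_le; apply/andP; split.
    apply: ge_ereal_sup => _ [a [_ aO] <-]; rewrite lee_fin.
    exact: (decay_rate_le hP lam'S mu'0 hS b_gt0 d_gt0 dE aO).
  (* Rates must be positive to count, hence the maximum with [b / 2]. *)
  apply/lee_subgt0Pr => e e_gt0.
  apply: (@le_trans _ _ (Num.max (b - e) (b / 2))%:E).
    by rewrite -EFinB lee_fin le_max lexx.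
  apply: ereal_sup_ubound; exists (Num.max (b - e) (b / 2)) => //.
  split=> [|i j]; first by rewrite lt_max divr_gt0 // orbT.
  have ab : Num.max (b - e) (b / 2) < b by rewrite gt_max; lra.
  have [K K_gt0 KP] := trans_prob_decay i j hP lam'S mu'0 lam'_ge0 mu'_ge0
    d_gt0 dE hp ab.
  apply/eqO_exP; exists K => //=.
  near=> t; rewrite [`|expR _|]ger0_norm ?expR_ge0 //; apply: KP.
  by near: t; exact: nbhs_pinfty_gt.
exists (\row_k d k); rewrite decayE.
have aE (i : 'I_S) : alpha lam mu (\row_k d k) i = b.
  by rewrite -alpha_trunc; exact: alphaE.
split=> [i||]; first by rewrite mxE d_gt0.
- by under eq_bigr do rewrite aE; rewrite big_mine_cst.
- by under eq_bigr do rewrite aE; rewrite big_maxe_cst.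
Unshelve. all: by end_near.
Qed.
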